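(* The inequality $\mathcal{Q}(p)\ge\mathcal{Q}(p')$ does not hold in general for a path $p$ of customers whose total expected demand respects the vehicle capacity and a subpath $p'$ of $p$. That is: there exist a capacity $Q>0$, finitely many customers with independent non-negative random demands $\xi_i$ of means $\mu_i$ and depot distances $c_{0i}\ge 0$, a path $p=(i_1,\dots,i_t)$ of customers with $\sum_{k=1}^t\mu_{i_k}\le Q$, and a subpath $p'$ of $p$, such that $\mathcal{Q}(p)<\mathcal{Q}(p')$.
   Context: A path $p=(i_1,\dots,i_t)$ is a finite sequence of distinct customers. A subpath of $p$ is a sequence obtained from $p$ by deleting some of its elements without changing the order of the remaining ones. For a path $p=(i_1,\dots,i_t)$, the expected recourse cost (detour-to-depot policy) in the given orientation is $$\mathcal{Q}^1(p)=2\sum_{j=1}^t\sum_{l=1}^\infty\mathbb{P}\left(\sum_{k=1}^{j-1}\xi_{i_k}\le lQ<\sum_{k=1}^{j}\xi_{i_k}\right)c_{0i_j},$$ $\mathcal{Q}^2(p)$ is the same quantity computed for the reversed path $(i_t,\dots,i_1)$, and $\mathcal{Q}(p)=\min\{\mathcal{Q}^1(p),\mathcal{Q}^2(p)\}$ is the expected recourse cost of the route $(0,i_1,\dots,i_t,0)$, where $0$ is the depot and $c_{0i}$ is the travel cost between the depot and customer $i$. *)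

(* Defs.v *)
From mathcomp Require Import all_boot all_order all_algebra.
From mathcomp Require Import all_classical all_reals all_analysis.

Set Implicit Arguments.
Unset Strict Implicit.
Unset Printing Implicit Defensive.

Import Order.TTheory GRing.Theory Num.Theory.

Local Open Scope classical_set_scope.
Local Open Scope ring_scope.

(* Mutual independence: the product rule over every finite subfamily J. *)
Definition mutually_independent d (T : measurableType d) (R : realType)
    (P : probability T R) (V : finType) (xi : V -> {RV P >-> R}) : Prop :=
  forall (J : {set V}) (A : V -> set R),
    (forall i, i \in J -> measurable (A i)) ->
    P (\bigcap_(i in [set` J]) (xi i @^-1` A i))
      = (\prod_(i in J) P (xi i @^-1` A i))%E.

Section Recourse.
Context d (T : measurableType d) (R : realType) (P : probability T R).
Context (V : finType) (xi : V -> {RV P >-> R}) (Q : R) (c0 : V -> R).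

Definition cumulative_demand (p : seq V) (j : nat) (w : T) : R :=
  \sum_(i <- take j p) xi i w.

(* With 0-based positions, the customers served strictly before position j are
   take j p, and those served up to and including it are take j.+1 p. *)
Definition failure_event (p : seq V) (j l : nat) : set T :=
  [set w | cumulative_demand p j w <= l%:R * Q < cumulative_demand p j.+1 w].

Definition oriented_recourse (p : seq V) : \bar R :=
  (2%:E * \sum_(j < size p)
     ((\sum_(1 <= l <oo) P (failure_event p j l))
        * (c0 (tnth (in_tuple p) j))%:E))%E.

Definition recourse (p : seq V) : \bar R :=
  Order.min (oriented_recourse p) (oriented_recourse (rev p)).

End Recourse.

(* Main.v *)
(** The capacity is 4; customer [a] demands 4 or 0 with probability 1/2 each,
    customers [e] and [b] demand exactly 1. When [a] demands 4, the route
    [(a, b)] fails at its last customer in either orientation, and both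
    customers are at distance 1 from the depot. On [(a, e, b)] the failure
    occurs at [e], which is located at the depot and so costs nothing, and no
    further failure occurs. *)

Require Import Defs.
From mathcomp Require Import all_boot all_order all_algebra.
From mathcomp Require Import all_classical all_reals all_analysis.
From HB Require Import structures.
From mathcomp Require Import unstable zify lra.

Import Order.TTheory GRing.Theory Num.Theory.
Local Open Scope classical_set_scope.
Local Open Scope ring_scope.

(** A constant variable pulls every set back to the whole space or to the empty set. If some
    preimage over [J] is empty, both sides of the product rule are 0; otherwise only the factor of
    [a], if [a] lies in [J], can differ from 1. *)
Lemma mutually_independent_constant_but_one d (T : measurableType d)
    (R : realType) (P : probability T R) (V : finType)
    (xi : V -> {RV P >-> R}) (a : V) :
  (forall i, i != a -> exists c, forall w, xi i w = c) ->
  mutually_independent xi.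
Proof.
move=> xiC J A mA.
have preimC i : i != a -> xi i @^-1` A i = setT \/ xi i @^-1` A i = set0.
  move=> /xiC[c xic]; have [Ac|nAc] := pselect (A i c).
    by left; apply/seteqP; split=> w //= _; rewrite xic.
  by right; apply/seteqP; split=> w //=; rewrite xic.
have [[i [iJ i0]]|none0] :=
    pselect (exists i, i \in J /\ xi i @^-1` A i = set0).
  rewrite (bigD1 i)//= i0 measure0 mul0e.
  rewrite (_ : bigcap _ _ = set0) ?measure0//.
  by apply/seteqP; split=> w //= /(_ i iJ); rewrite i0.
have preimT i : i \in J -> i != a -> xi i @^-1` A i = setT.
  by move=> iJ /preimC[//|i0]; case: none0; exists i.
have [aJ|aJ] := boolP (a \in J).
  rewrite (bigD1 a)//= big1 ?mule1; last first.
    by move=> i /andP[iJ ia]; rewrite preimT// probability_setT.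
  congr (P _); apply/seteqP; split=> w; first exact.
  move=> wa i /= iJ; have [->//|ia] := eqVneq i a.
  by have /seteqP[_ /(_ w)] := preimT _ iJ ia; exact.
have JT i : i \in J -> xi i @^-1` A i = setT.
  by move=> iJ; apply: preimT => //; apply: contraNneq aJ => <-.
rewrite big1; last by move=> i iJ; rewrite JT// probability_setT.
rewrite (_ : bigcap _ _ = setT) ?probability_setT//.
apply/seteqP; split=> w // _ i /= iJ.
by have /seteqP[_ /(_ w)] := JT _ iJ; exact.
Qed.

Section OrientedRecourse.
Context d (T : measurableType d) (R : realType) (P : probability T R).
Context (V : finType) (xi : V -> {RV P >-> R}) (Q : R) (c0 : V -> R).

Lemma oriented_recourse_eq0 (p : seq V) :
  (forall j : 'I_(size p), c0 (tnth (in_tuple p) j) = 0 \/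
     forall l, (0 < l)%N -> failure_event xi Q p j l = set0) ->
  oriented_recourse xi Q c0 p = 0%E.
Proof.
move=> p0; rewrite /oriented_recourse big1 ?mule0// => j _.
have [->|f0] := p0 j; first by rewrite mule0.
by rewrite eseries0 ?mul0e// => l l1 _; rewrite f0// measure0.
Qed.

(** All terms are non-negative, so one positive term suffices and no recourse cost has to be
    evaluated exactly. *)
Lemma oriented_recourse_gt0 (p : seq V) (j : 'I_(size p)) (l : nat) :
  (forall i, 0 <= c0 i) -> 0 < c0 (tnth (in_tuple p) j) -> (0 < l)%N ->
  (0 < P (failure_event xi Q p j l))%E ->
  (0 < oriented_recourse xi Q c0 p)%E.
Proof.
move=> c0_ge0 cj_gt0 l_gt0 Pjl.
have series_ge0 (k : 'I_(size p)) :
    (0 <= \sum_(1 <= l <oo) P (failure_event xi Q p k l))%E.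
  by apply: nneseries_ge0 => *; exact: measure_ge0.
rewrite /oriented_recourse mule_gt0// (bigD1 j)//=.
apply: lt_le_trans (leeDl _ _); last first.
  by apply: sume_ge0 => k _; rewrite mule_ge0// lee_fin.
rewrite mule_gt0// ?lte_fin//.
(* Cutting the series at [l.+1] makes the term of index [l] the last one of the partial sum. *)
apply: lt_le_trans (nneseries_lim_ge l.+1 _) => //.
rewrite big_nat_recr//=; apply: lt_le_trans Pjl _.
by rewrite leeDr// sume_ge0.
Qed.

End OrientedRecourse.

Section Counterexample.
Context (R : realType).

Local Notation coin := (bernoulli_prob (2^-1 : R)).

Lemma half_itv01 : 0 <= (2^-1 : R) <= 1.
Proof. lra. Qed.

Lemma coin_gt0 (A : set bool) : A true -> (0 < coin A)%E.
Proof.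
move=> At; rewrite bernoulli_probE ?half_itv01//.
rewrite diracE mem_set// mule1.
apply: (@lt_le_trans _ _ (2^-1 : R)%:E); first by rewrite lte_fin invr_gt0.
by rewrite leeDl// mule_ge0// lee_fin /onem; lra.
Qed.

(** Indices 0, 1, 2 stand for $a$, $e$, $b$. Integer demands turn failure events into inequalities
    in [nat], settled by computation or [lia]. *)
Definition demandn (i : 'I_3) (w : bool) : nat :=
  if i == 0 :> nat then (4 * w)%N else 1%N.

Definition demand (i : 'I_3) (w : bool) : R := (demandn i w)%:R.

Lemma measurable_demand (i : 'I_3) : measurable_fun [set: bool] (demand i).
Proof. by []. Qed.

HB.instance Definition _ (i : 'I_3) :=
  isMeasurableFun.Build _ _ _ _ (demand i) (measurable_demand i).

Definition demandRV (i : 'I_3) : {RV coin >-> R} := demand i.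

Definition distance (i : 'I_3) : R := (i != 1 :> nat)%:R.

Definition mean (i : 'I_3) : R := if i == 0 :> nat then 2 else 1.

Lemma expectation_demand (i : 'I_3) : ('E_coin[demandRV i] = (mean i)%:E)%E.
Proof.
rewrite expectation_def integral_bernoulli_prob ?half_itv01//; last first.
  by move=> w; rewrite lee_fin ler0n.
rewrite -!EFinM -EFinD /= /demand /demandn /mean /onem; congr EFin.
by case: ifP => _ /=; rewrite ?muln1 ?muln0; lra.
Qed.

Lemma cumulative_demandE (p : seq 'I_3) (j : nat) (w : bool) :
  cumulative_demand demandRV p j w = (\sum_(i <- take j p) demandn i w)%N%:R.
Proof. by rewrite natr_sum. Qed.

Lemma failure_eventE (p : seq 'I_3) (j l : nat) (w : bool) :
  failure_event demandRV 4 p j l w =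
  (\sum_(i <- take j p) demandn i w <= l * 4
     < \sum_(i <- take j.+1 p) demandn i w)%N.
Proof.
rewrite /failure_event /= !cumulative_demandE.
by rewrite -(natrM _ l 4) ler_nat ltr_nat.
Qed.

Let a : 'I_3 := @Ordinal 3 0 isT.
Let e : 'I_3 := @Ordinal 3 1 isT.
Let b : 'I_3 := @Ordinal 3 2 isT.

(** Serving $a$ brings the load to at most 4, which does not exceed $4l$ for $l\ge 1$. Serving $b$
    takes it from 5 to 6 or from 1 to 2, crossing no multiple of 4. A failure at $e$ is free. *)
Lemma oriented_recourse_detour :
  oriented_recourse demandRV 4 distance [:: a; e; b] = 0%E.
Proof.
apply: oriented_recourse_eq0 => -[[|[|[|//]]] j3] /=; [right|by left|right];
  move=> l l_gt0; apply/seteqP; split=> w //;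
  rewrite failure_eventE /= !big_cons !big_nil /demandn /=; case: w => /=; lia.
Qed.

(** On the outcome [true] the load before the last customer is 4 or 1, depending on the order, and 5
    after it. Hence the threshold with $l=1$ is crossed there, at distance 1 from the depot. *)
Lemma oriented_recourse_pair_gt0 (p : seq 'I_3) :
  p = [:: a; b] \/ p = [:: b; a] ->
  (0 < oriented_recourse demandRV 4 distance p)%E.
Proof.
have gt0 (x y : 'I_3) : distance y = 1 ->
    failure_event demandRV 4 [:: x; y] 1 1 true ->
    (0 < oriented_recourse demandRV 4 distance [:: x; y])%E.
  move=> y1 fail; pose j : 'I_(size [:: x; y]) := ord_max.
  apply: (@oriented_recourse_gt0 _ _ _ _ _ _ _ _ _ j 1%N) => //.
  - by rewrite (tnth_nth x) y1.
  - exact: coin_gt0.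
by case=> ->; apply: gt0; rewrite // failure_eventE /= !big_cons !big_nil.
Qed.

End Counterexample.

Theorem proposition10 (R : realType) :
  exists (d : measure_display) (T : measurableType d) (P : probability T R)
    (n : nat) (xi : 'I_n -> {RV P >-> R}) (mu : 'I_n -> R)
    (Q : R) (c0 : 'I_n -> R) (p p' : seq 'I_n),
    0 < Q /\
    (forall i w, 0 <= xi i w) /\
    (forall i, ('E_P[xi i] = (mu i)%:E)%E) /\
    mutually_independent xi /\
    (forall i, 0 <= c0 i) /\
    uniq p /\
    \sum_(i <- p) mu i <= Q /\
    subseq p' p /\
    (recourse xi Q c0 p < recourse xi Q c0 p')%E.
Proof.
pose a : 'I_3 := @Ordinal 3 0 isT.
pose e : 'I_3 := @Ordinal 3 1 isT.
pose b : 'I_3 := @Ordinal 3 2 isT.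
exists _, bool, (bernoulli_prob (2^-1 : R)), 3, (demandRV R), (mean R), 4,
  (distance R), [:: a; e; b], [:: a; b].
split; first by rewrite ltr0n.
split; first by move=> i w; rewrite ler0n.
split; first exact: expectation_demand.
split.
  apply: (@mutually_independent_constant_but_one _ _ _ _ _ _ a) => i ia.
  by exists 1 => w; rewrite /= /demand /demandn ifN.
split; first by move=> i; rewrite ler0n.
split; first by [].
(* The mean demands sum to $2+1+1=4$, exactly the capacity. *)
split; first by rewrite !big_cons big_nil /mean /=; lra.
split; first by [].
rewrite /recourse oriented_recourse_detour.
(* One free orientation bounds the minimum for the full path by 0; for the subpath both orientations
   must be positive. *)
apply: (@le_lt_trans _ _ 0%E); first by rewrite ge_min lexx.
by rewrite lt_min !oriented_recourse_pair_gt0//; [right|left].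
Qed.
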